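(* For every integer $k\ge 1$, $\mathsf{Pathwidth}(k+1)\cap\mathsf{Trees}\not\rightsquigarrow\mathsf{Pathwidth}(k)$; that is, there is no $D<\infty$ such that every metric supported on a tree of pathwidth at most $k+1$ admits a stochastic $D$-embedding into the family of metrics supported on graphs of pathwidth at most $k$.
   Context: Graphs are finite, undirected, without loops or parallel edges. The pathwidth of a graph is the minimum width of a path decomposition (a tree decomposition whose underlying tree is a path; width = maximum bag size minus one). $\mathsf{Pathwidth}(k)$ is the family of all graphs of pathwidth at most $k$, and $\mathsf{Trees}$ is the family of connected acyclic graphs. For a graph $G=(V,E)$ and $\mathrm{len}:E\to[0,\infty)$, $d_{\mathrm{len}}$ denotes the induced shortest-path pseudometric on $V$ (distance $0$ between distinct vertices is allowed; the distance between vertices in different components is $\infty$). A (pseudo)metric $d$ on $V$ is supported on $G$ if $d=d_{\mathrm{len}}$ for some such $\mathrm{len}$, and is supported on a family of graphs if it is supported on some member. If $(X,d)$ is a finite (pseudo)metric space and $\mathcal Y$ a family of finite (pseudo)metric spaces, $(X,d)$ admits a stochastic $D$-embedding into $\mathcal Y$ if there exist a randomly chosen space $(Y,d_Y)\in\mathcal Y$ and a randomly chosen map $F:X\to Y$ (jointly distributed) such that (i) with probability one, $d_Y(F(x),F(y))\ge d(x,y)$ for all $x,y\in X$; and (ii) $\mathbb E[d_Y(F(x),F(y))]\le D\cdot d(x,y)$ for all $x,y\in X$. For graph families $\mathcal F,\mathcal G$, $\mathcal F\rightsquigarrow\mathcal G$ means that there exists $D<\infty$ such that every metric supported on $\mathcal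 F$ admits a stochastic $D$-embedding into the family of metrics supported on $\mathcal G$, and $\mathcal F\not\rightsquigarrow\mathcal G$ means that no such $D$ exists. *)

(* Defs.v *)
From HB Require Import structures.
From mathcomp Require Import all_boot all_order all_algebra.
From mathcomp Require Import all_classical all_reals all_analysis.
(* Imported again, last, so that the measurable structure of [\bar R] is found. *)
From mathcomp Require Import measurable_realfun.

Set Implicit Arguments.
Unset Strict Implicit.
Unset Printing Implicit Defensive.

Import Order.TTheory GRing.Theory Num.Theory.

Local Open Scope classical_set_scope.
Local Open Scope ring_scope.

(** * Graphs, trees and pathwidth *)

Record sgraph : Type := SGraph {
  vertex :> finType;
  edge : rel vertex;
  edge_sym : symmetric edge;
  edge_irr : irreflexive edge }.

Definition connected_graph (G : sgraph) : Prop :=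
  (0 < #|G|)%N /\ forall x y : G, connect (@edge G) x y.

(* A closed walk without repeated vertices is a cycle of the graph only when
   it has at least three vertices: any edge gives a [ucycle] of size 2. *)
Definition acyclic_graph (G : sgraph) : Prop :=
  forall c : seq G, (2 < size c)%N -> ~ ucycle (@edge G) c.

(* Families are plain predicates: [set sgraph] is excluded by the universe level
   of [set]. *)
Definition graph_family : Type := sgraph -> Prop.

Definition familyI (F G : graph_family) : graph_family := fun H => F H /\ G H.

Definition Trees : graph_family :=
  fun G => connected_graph G /\ acyclic_graph G.

Definition induces_connected (G : sgraph) (S : {set G}) : Prop :=
  forall s t : G, s \in S -> t \in S ->
    connect [rel a b : G | [&& edge a b, a \in S & b \in S]] s t.

Record tree_decomposition (G T : sgraph) (bag : T -> {set G}) : Prop :=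
  TreeDecomposition {
    td_tree : Trees T;
    td_vertex : forall v : G, exists t : T, v \in bag t;
    td_edge : forall u v : G, edge u v ->
      exists t : T, (u \in bag t) && (v \in bag t);
    td_subtree : forall v : G, induces_connected [set t : T | v \in bag t] }.

(* The truncated predecessor only matters for the graph without vertices, which
   gets width 0 instead of -1. *)
Definition width (G T : sgraph) (bag : T -> {set G}) : nat :=
  (\max_(t : T) #|bag t|).-1.

Section PathGraph.
Variable n : nat.

Definition path_edge : rel 'I_n :=
  fun i j => (i.+1 == j :> nat) || (j.+1 == i :> nat).

Lemma path_edge_sym : symmetric path_edge.
Proof. by move=> i j; rewrite /path_edge orbC. Qed.

Lemma path_edge_irr : irreflexive path_edge.
Proof. by move=> i; rewrite /path_edge orbb; apply/eqP => /esym/n_Sn. Qed.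

Definition path_graph : sgraph := SGraph path_edge_sym path_edge_irr.

End PathGraph.

Definition has_path_decomposition (G : sgraph) (w : nat) : Prop :=
  exists (n : nat) (bag : path_graph n -> {set G}),
    tree_decomposition bag /\ width bag = w.

Lemma path_graph1_tree : Trees (path_graph 1).
Proof.
split; first split.
- by rewrite card_ord.
- by move=> x y; rewrite (ord1 x) (ord1 y) connect0.
- case=> [|x [|y c]] //= _ /andP[_ /=].
  by rewrite (ord1 x) (ord1 y) inE eqxx.
Qed.

Lemma ex_path_decomposition (G : sgraph) :
  exists w, `[< has_path_decomposition G w >].
Proof.
exists (width (fun _ : path_graph 1 => [set: G]%SET)); apply/asboolP.
exists 1%N, (fun _ => [set: G]%SET); split=> //; split.
- exact: path_graph1_tree.
- by move=> v; exists ord0; rewrite inE.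
- by move=> u v _; exists ord0; rewrite !inE.
- by move=> v s t _ _; rewrite (ord1 s) (ord1 t) connect0.
Qed.

Definition pathwidth (G : sgraph) : nat := ex_minn (ex_path_decomposition G).

Definition Pathwidth (k : nat) : graph_family := fun G => (pathwidth G <= k)%N.

(** * Finite pseudometric spaces and metrics supported on graphs *)

Record finpmetric (R : realType) : Type := FinPMetric {
  point_of :> finType;
  dist : point_of -> point_of -> \bar R;
  dist_ge0 : forall x y, (0 <= dist x y)%E;
  dist_refl : forall x, dist x x = 0%E;
  dist_sym : forall x y, dist x y = dist y x;
  dist_triangle : forall x y z, (dist x z <= dist x y + dist y z)%E }.

(* The values of [len] on pairs that are not edges are irrelevant. *)
Record edge_length (R : realType) (G : sgraph) : Type := EdgeLength {
  len :> G -> G -> R;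
  len_ge0 : forall x y, edge x y -> 0 <= len x y;
  len_sym : forall x y, edge x y -> len x y = len y x }.

Section GraphMetric.
Variables (R : realType) (G : sgraph) (l : edge_length R G).

Definition walk_length (x : G) (p : seq G) : R := \sum_(a <- pairmap l x p) a.

Definition walks (x y : G) : set (seq G) :=
  [set p | path (@edge G) x p /\ last x p = y].

(* [ereal_inf set0 = +oo], so vertices in different components are at infinite
   distance; the empty walk gives distance 0 from a vertex to itself. *)
Definition graph_dist (x y : G) : \bar R :=
  ereal_inf [set (walk_length x p)%:E | p in walks x y].

Lemma walk_length_ge0 x p : path (@edge G) x p -> 0 <= walk_length x p.
Proof.
rewrite /walk_length; elim: p x => [|y p IH] x /=; first by rewrite big_nil.
by move=> /andP[exy /IH ?]; rewrite big_cons addr_ge0 ?len_ge0.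
Qed.

Lemma walk_length_cat x p q :
  walk_length x (p ++ q) = walk_length x p + walk_length (last x p) q.
Proof. by rewrite /walk_length pairmap_cat big_cat. Qed.

Lemma walk_rev x y p : walks x y p ->
  exists2 q, walks y x q & walk_length y q = walk_length x p.
Proof.
elim: p x => [|z p IH] x [/= + +].
  by move=> _ <-; exists [::].
move=> /andP[exz pz] lz.
have [q [qp ql] qE] := IH z (conj pz lz).
exists (rcons q x).
  by split; rewrite ?last_rcons// rcons_path qp ql edge_sym.
rewrite -cats1 walk_length_cat qE ql {2 3}/walk_length /= big_cons big_nil.
by rewrite big_cons addr0 addrC (len_sym l exz).
Qed.

Lemma graph_dist_ge0 x y : (0 <= graph_dist x y)%E.
Proof.
by apply: le_ereal_inf_tmp => _ [p [pp _] <-]; rewrite lee_fin walk_length_ge0.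
Qed.

Lemma graph_dist_refl x : graph_dist x x = 0%E.
Proof.
apply/eqP; rewrite eq_le graph_dist_ge0 andbT.
by apply: ereal_inf_lbound; exists [::] => //; rewrite /walk_length big_nil.
Qed.

Lemma graph_dist_sym x y : graph_dist x y = graph_dist y x.
Proof.
by rewrite /graph_dist; congr ereal_inf; apply/seteqP; split => _ [p /walk_rev[q wq <-] <-];
  exists q.
Qed.

Lemma graph_dist_triangle x y z :
  (graph_dist x z <= graph_dist x y + graph_dist y z)%E.
Proof.
have [->|fxy] := eqVneq (graph_dist x y) +oo%E.
  by rewrite addye ?leey// gt_eqF// (lt_le_trans _ (graph_dist_ge0 _ _)) ?ltNy0.
have [->|fyz] := eqVneq (graph_dist y z) +oo%E.
  by rewrite addey ?leey// gt_eqF// (lt_le_trans _ (graph_dist_ge0 _ _)) ?ltNy0.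
have fin u v : graph_dist u v != +oo%E -> graph_dist u v \is a fin_num.
  by move=> h; rewrite ge0_fin_numE ?graph_dist_ge0// ltey.
apply/lee_addgt0Pr => e e0.
have e20 : 0 < e / 2 by rewrite divr_gt0.
have [_ [p [pp pl] <-] hp] := lb_ereal_inf_adherent e20 (fin _ _ fxy).
have [_ [q [qp ql] <-] hq] := lb_ereal_inf_adherent e20 (fin _ _ fyz).
apply: (@le_trans _ _ (walk_length x (p ++ q))%:E).
  apply: ereal_inf_lbound; exists (p ++ q) => //.
  by split; rewrite ?cat_path ?last_cat pl // pp qp.
rewrite walk_length_cat pl EFinD [e in (_ + _ + e%:E)%E]splitr EFinD addeACA.
exact: leeD (ltW hp) (ltW hq).
Qed.

Definition graph_metric : finpmetric R :=
  FinPMetric graph_dist_ge0 graph_dist_refl graph_dist_sym graph_dist_triangle.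

End GraphMetric.

Definition supported_on (R : realType) (F : graph_family) (X : finpmetric R) :
    Prop :=
  exists2 G : sgraph, F G & exists l : edge_length R G, X = graph_metric l.

(** * Stochastic embeddings *)

(* The random pair (space, map) is a function on an arbitrary probability
   space.  The only measurability required of it is that each of the distances
   [dist (F w x) (F w y)] is a random variable, with values in the extended reals. *)
Definition stochastic_embedding (R : realType) (D : R) (X : finpmetric R)
    (YY : finpmetric R -> Prop) : Prop :=
  exists (d : measure_display) (Omega : measurableType d)
    (P : probability Omega R) (Y : Omega -> finpmetric R)
    (F : forall w : Omega, X -> Y w),
    [/\ forall w, YY (Y w),
        forall x y : X, measurable_fun setT (fun w => dist (F w x) (F w y)),
        {ae P, forall w, forall x y : X,
           (dist x y <= dist (F w x) (F w y))%E}
      & forall x y : X,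
          (\int[P]_w dist (F w x) (F w y) <= D%:E * dist x y)%E].

Definition embeds_into (R : realType) (F G : graph_family) : Prop :=
  exists D : R, forall X : finpmetric R, supported_on F X ->
    stochastic_embedding D X (@supported_on R G).

(* Main.v *)
Require Import Defs.
From mathcomp Require Import all_boot all_order all_algebra.
From mathcomp Require Import all_classical all_reals all_analysis.
From mathcomp Require Import measurable_realfun.
From mathcomp Require Import ring lra zify.

(** Let [T_0] be a point and let [T_(j+1)] be a root joined by very long edges to
    many copies of [T_j]; then [T_(k+1)] has pathwidth at most [k + 1].  By
    induction on [j], if a noncontracting map of [T_j] into a graph stretches the
    edges by a bounded factor on average, and each edge is drawn as a walk, then
    every path decomposition of the graph has a bag containing [j + 1] vertices of
    the drawing.  Indeed, most copies of [T_j] are drawn cheaply, hence in small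
    and pairwise distant sets, each of which meets some bag in [j + 1] vertices.
    If no bag met the whole drawing in [j + 2] vertices, then each of these bags
    would meet the drawing only in its own copy.  The walk from the copy with the
    leftmost bag through the root to the copy with the rightmost bag crosses all
    the bags, so it would visit all the distant copies, which is too long.  With
    [j = k + 1], no noncontracting map into a graph of pathwidth at most [k] has
    bounded average stretch; but a stochastic embedding has one in its support. *)

Set Implicit Arguments.
Unset Strict Implicit.
Unset Printing Implicit Defensive.

Import Order.TTheory GRing.Theory Num.Theory.

Local Open Scope ring_scope.

(** * Path decompositions *)

(** At a highest vertex of a cycle both neighbours are lower, hence equal, while a cycle with at
    least three vertices has them distinct. *)
Lemma height_acyclic (G : sgraph) (h : G -> nat) :
  (forall x y, edge x y -> h x != h y) ->
  (forall x y z, edge x y -> edge x z -> (h y < h x)%N -> (h z < h x)%N ->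
     y = z) ->
  acyclic_graph G.
Proof.
move=> hneq huniq c c2 /andP[cyc unc].
have [x0 x0c] : exists x0, x0 \in c.
  by case: c c2 {cyc unc} => // a c _; exists a; rewrite mem_head.
have [x xc xmax] : exists2 x, x \in c & forall y, y \in c -> (h y <= h x)%N.
  by case: (@arg_maxnP _ x0 [in c] h x0c) => x xc xm; exists x.
case/rot_to: xc => i c' cE.
have {}cyc : cycle (@edge G) (x :: c') by rewrite -cE rot_cycle.
have {}unc : uniq (x :: c') by rewrite -cE rot_uniq.
have {}c2 : (2 < size (x :: c'))%N by rewrite -cE size_rot.
have {}xmax y : y \in x :: c' -> (h y <= h x)%N by rewrite -cE mem_rot; apply: xmax.
case: c' => [|y c'] in cE cyc unc c2 xmax *; first by [].
case/lastP: c' => [|c' z] in cE cyc unc c2 xmax *; first by [].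
move: cyc; rewrite /= rcons_path last_rcons => /andP[exy /andP[_ ezx]].
have lower w : w \in [:: x, y & rcons c' z] -> edge x w -> (h w < h x)%N.
  by move=> wc exw; rewrite ltn_neqAle xmax// eq_sym hneq.
have yz : y = z.
  by apply: (huniq x); rewrite ?lower// ?(edge_sym x z)// !inE ?eqxx ?orbT//
    mem_rcons mem_head !orbT.
by move: unc; rewrite /= yz mem_rcons mem_head /= andbF.
Qed.

Lemma path_graph_interval (n : nat) (S : {set path_graph n}) :
  (forall a b c : 'I_n, a \in S -> c \in S -> (a <= b <= c)%N -> b \in S) ->
  induces_connected S.
Proof.
move=> cvx.
have up k (a c : 'I_n) : (c = a + k :> nat)%N -> a \in S -> c \in S ->
    connect [rel a b : path_graph n | [&& edge a b, a \in S & b \in S]] a c.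
  elim: k a => [|k IH] a cE aS cS.
    by rewrite (_ : c = a) ?connect0//; apply: val_inj; rewrite /= cE addn0.
  have a1n : (a.+1 < n)%N by have := ltn_ord c; lia.
  have a1S : Ordinal a1n \in S by apply: (cvx a _ c); rewrite //=; lia.
  apply: connect_trans (IH (Ordinal a1n) _ a1S cS); last by rewrite /= cE; lia.
  by apply: connect1; rewrite /= aS a1S /path_edge /= eqxx.
move=> a c aS cS; case: (leqP a c) => ac.
  by apply: (up (c - a)%N) => //; lia.
rewrite sym_connect_sym; first by apply: (up (a - c)%N) => //; lia.
by move=> x y /=; rewrite path_edge_sym (andbC (x \in S)).
Qed.

Lemma path_graph_tree n : Trees (path_graph n.+1).
Proof.
split; first split.
- by rewrite card_ord.
- move=> x y.
  have conn : @induces_connected (path_graph n.+1) [set: _]%SET.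
    by apply: path_graph_interval => *; rewrite inE.
  apply: connect_sub (conn x y (finset.in_setT _) (finset.in_setT _)) => a b /and3P[? _ _].
  exact: connect1.
- apply: (@height_acyclic (path_graph n.+1) (fun i : 'I_n.+1 => i : nat)) => [x y|x y z] /=.
    by rewrite /path_edge; lia.
  by rewrite /path_edge => *; apply: val_inj => /=; lia.
Qed.

(** Vertex [v] is put into the bags numbered from [lo v] to [hi v - 1]. *)
Lemma pathwidth_interval (G : sgraph) (n w : nat) (lo hi : G -> nat) :
  (0 < n)%N -> (forall v, lo v < hi v <= n)%N ->
  (forall u v, edge u v -> (lo u < hi v)%N) ->
  (forall t, #|[set v | lo v <= t < hi v]%N| <= w.+1)%N ->
  Pathwidth w G.
Proof.
case: n => // n _ lohi meet card.
pose bag (t : path_graph n.+1) : {set G} := [set v | lo v <= t < hi v]%N.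
have wbag : (width bag <= w)%N.
  rewrite /width -subn1 leq_subLR add1n.
  by apply/bigmax_leqP => t _; apply: card.
suff dec : tree_decomposition bag.
  rewrite /Pathwidth /pathwidth; case: ex_minnP => w0 _ min.
  by apply: leq_trans wbag; apply: min; apply/asboolP; exists n.+1, bag.
split.
- exact: path_graph_tree.
- move=> v; have /andP[lh hn] := lohi v.
  by exists (Ordinal (leq_trans lh hn)); rewrite inE /= leqnn.
- move=> u v euv; have uv := meet _ _ euv.
  have vu : (lo v < hi u)%N by apply: meet; rewrite edge_sym.
  have [/andP[lu hu] /andP[lv hv]] := (lohi u, lohi v).
  (* Each interval starts before the other ends, so the later of the two left ends lies in both. *)
  have tn : (maxn (lo u) (lo v) < n.+1)%N by lia.
  by exists (Ordinal tn); rewrite !inE /=; lia.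
- move=> v; apply: path_graph_interval => a b c; rewrite !inE; lia.
Qed.

(** A path from [a] to [c] among the bags of [v] changes the index by one at each step, so it cannot
    jump over [b]. *)
Lemma path_decomposition_interval (G : sgraph) (n : nat)
    (bag : path_graph n -> {set G}) (v : G) (a b c : 'I_n) :
  induces_connected [set t | v \in bag t] ->
  v \in bag a -> v \in bag c -> (a <= b <= c)%N -> v \in bag b.
Proof.
move=> conn va vc /andP[ab bc].
have /connectP[p + +] := conn a c ltac:(by rewrite inE) ltac:(by rewrite inE).
elim: p a va ab => [|x p IH] a va ab /=.
  move=> _ ca; suff -> : b = a by [].
  by apply: val_inj; move: bc; rewrite ca /=; lia.
rewrite /= !inE => /andP[/and3P[ax _ vx] px] lx.
have [xb|bx] := leqP x b; first exact: (IH x).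
suff -> : b = a by [].
by apply: val_inj => /=; move: ax; rewrite /path_edge; lia.
Qed.

(** * Spherically symmetric trees *)

Section Tree.
Variable R : realType.
Implicit Types s : seq (nat * R).

(* The list [(m, L) :: s] encodes the tree whose root has [m + 1] children, at
   distance [L], each of them the root of a copy of the tree encoded by [s]. *)
Fixpoint tvert s : finType :=
  if s is mL :: s' then option ('I_mL.1.+1 * tvert s') : finType
  else unit : finType.

Definition troot s : tvert s := if s is mL :: s' then None else tt.

Fixpoint child s : rel (tvert s) :=
  match s return rel (tvert s) with
  | [::] => fun _ _ => false
  | mL :: s' => fun u v => match u, v with
    | None, Some (i, y) => (y : tvert s') == troot s'
    | Some (i, x), Some (j, y) => (i == j) && child x y
    | _, _ => false
    end
  end.

Fixpoint edges s : seq (tvert s * tvert s * R) :=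
  match s return seq (tvert s * tvert s * R) with
  | [::] => [::]
  | mL :: s' =>
    flatten [seq (None, Some (i, troot s'), mL.2) ::
                 [seq (Some (i, e.1.1), Some (i, e.1.2), e.2) | e <- edges s']
            | i : 'I_mL.1.+1]
  end.

(* An ultrametric bounding the tree metric from below, with equality on edges:
   the length of the edges leaving the last common ancestor. *)
Fixpoint udist s : tvert s -> tvert s -> R :=
  match s return tvert s -> tvert s -> R with
  | [::] => fun _ _ => 0
  | mL :: s' => fun u v => match u, v with
    | None, None => 0
    | Some (i, x), Some (j, y) => if i == j then udist x y else mL.2
    | _, _ => mL.2
    end
  end.

(** Lengths do not increase away from the root; this gives [udist] its triangle inequality. *)
Fixpoint scales s : Prop :=
  if s is mL :: s' then
    [/\ 0 < mL.2, forall e, e \in s' -> e.2 <= mL.2 & scales s']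
  else True.

Fixpoint tdepth s : tvert s -> nat :=
  match s return tvert s -> nat with
  | [::] => fun _ => 0%N
  | mL :: s' => fun u => if u is Some (i, x) then (tdepth x).+1 else 0%N
  end.

Fixpoint leaves s : nat := if s is mL :: s' then (mL.1.+1 * leaves s')%N else 1%N.

(* The leaves below a vertex are numbered from [leaf_lo] to [leaf_hi - 1]; the
   bag of a leaf will be the set of its ancestors. *)
Fixpoint leaf_lo s : tvert s -> nat :=
  match s return tvert s -> nat with
  | [::] => fun _ => 0%N
  | mL :: s' => fun u => if u is Some (i, x) then (i * leaves s' + leaf_lo x)%N else 0%N
  end.

Fixpoint leaf_hi s : tvert s -> nat :=
  match s return tvert s -> nat with
  | [::] => fun _ => 1%N
  | mL :: s' => fun u =>
     if u is Some (i, x) then (i * leaves s' + leaf_hi x)%N else (mL.1.+1 * leaves s')%N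
  end.

Lemma tvert_ind mL s (P : tvert (mL :: s) -> Prop) :
  (forall i (x : tvert s), P (Some (i, x))) -> P None -> forall u, P u.
Proof. by move=> PS PN [[i x]|]. Qed.

Lemma tdepth_root s : tdepth (troot s) = 0%N.
Proof. by case: s. Qed.

Lemma child_depth s (u v : tvert s) : child u v -> tdepth v = (tdepth u).+1.
Proof.
elim: s u v => [//|[m L] s IH] u v;
  elim/tvert_ind: u => [i x|]; elim/tvert_ind: v => [j y|] //=.
  by move=> /andP[_ /IH ->].
by move=> /eqP yr; rewrite yr tdepth_root.
Qed.

Lemma child_uniq s (u u' v : tvert s) : child u v -> child u' v -> u = u'.
Proof.
elim: s u u' v => [//|[m L] s IH] u u' v;
  elim/tvert_ind: u => [i x|]; elim/tvert_ind: u' => [i' x'|];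
  elim/tvert_ind: v => [j y|] //=.
- by move=> /andP[/eqP -> xy] /andP[/eqP -> x'y]; rewrite (IH _ _ _ xy x'y).
- by move=> /andP[_ /child_depth +] /eqP yr; rewrite yr tdepth_root.
- by move=> /eqP yr /andP[_ /child_depth]; rewrite yr tdepth_root.
Qed.

Definition tedge s : rel (tvert s) := fun u v => child u v || child v u.

Lemma tedge_sym s : symmetric (@tedge s).
Proof. by move=> u v; rewrite /tedge orbC. Qed.

Lemma tedge_irr s : irreflexive (@tedge s).
Proof. by move=> u; apply/negP; rewrite /tedge orbb => /child_depth; lia. Qed.

Definition tree s : sgraph := SGraph (@tedge_sym s) (@tedge_irr s).

Lemma tree_acyclic s : acyclic_graph (tree s).
Proof.
apply: (@height_acyclic (tree s) (@tdepth s)) => [x y|x y z] /=.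
  by move=> /orP[] /child_depth; lia.
move=> /orP[/child_depth|yx]; first by lia.
move=> /orP[/child_depth|zx]; first by lia.
by move=> _ _; apply: child_uniq yx zx.
Qed.

Lemma tree_connected_root s (v : tree s) : connect (@edge (tree s)) (troot s) v.
Proof.
elim: s v => [|[m L] s IH]; first by case.
elim/tvert_ind => [i v|]; last exact: connect0.
pose h x : tree ((m, L) :: s) := Some (i, x).
apply: (@connect_trans _ _ (h (troot s))).
  by apply: connect1; rewrite /= /tedge /= eqxx.
have /connectP[p pp vE] := IH v.
apply/connectP; exists (map h p); last by rewrite last_map -vE.
by rewrite path_map; apply: sub_path pp => x y /=; rewrite /tedge /= eqxx.
Qed.

Lemma tree_is_tree s : Trees (tree s).
Proof.
split; last exact: tree_acyclic.
split=> [|x y]; first by apply/card_gt0P; exists (troot s).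
apply: connect_trans (tree_connected_root y).
by rewrite sym_connect_sym ?tree_connected_root//; apply: tedge_sym.
Qed.

Lemma leaves_gt0 s : (0 < leaves s)%N.
Proof. by elim: s => //= mL s IH; rewrite muln_gt0 IH. Qed.

Lemma leaf_bounds s (v : tvert s) : (leaf_lo v < leaf_hi v <= leaves s)%N.
Proof.
elim: s v => [|[m L] s IH]; first by case.
elim/tvert_ind => [i v|] /=; last by rewrite muln_gt0 leaves_gt0 leqnn.
have /andP[lh hn] := IH v.
rewrite ltn_add2l lh /=; apply: (@leq_trans (i.+1 * leaves s)).
  by rewrite mulSn addnC leq_add2r.
by rewrite leq_mul2r ltn_ord orbT.
Qed.

Lemma child_leaf s (u v : tvert s) : child u v ->
  (leaf_lo u <= leaf_lo v)%N /\ (leaf_hi v <= leaf_hi u)%N.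
Proof.
elim: s u v => [//|[m L] s IH] u v;
  elim/tvert_ind: u => [i x|]; elim/tvert_ind: v => [j y|] //=.
  by move=> /andP[/eqP -> /IH[? ?]]; rewrite !leq_add2l.
by move=> _; have /andP[] := @leaf_bounds ((m, L) :: s) (Some (j, y)).
Qed.

(** Leaf [t] lies in copy number [t %/ leaves s] and has number [t %% leaves s] there; its ancestors
    are the root and its ancestors inside that copy. *)
Lemma card_leaf_bag s t :
  (#|[set v : tvert s | leaf_lo v <= t < leaf_hi v]%N| <= (size s).+1)%N.
Proof.
elim: s t => [|[m L] s IH] t; first by rewrite (leq_trans (max_card _)) // card_unit.
set A := [set v | _].
have [tm|tm] := ltnP (t %/ leaves s) m.+1; last first.
  suff -> : A = finset.set0 by rewrite cards0.
  apply/setP => v; rewrite !inE; apply/negP => /andP[_ tv].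
  have /andP[_ vn] := @leaf_bounds ((m, L) :: s) v.
  move: tm; rewrite leq_divRL ?leaves_gt0// leqNgt => /negP; apply.
  exact: leq_trans tv vn.
set B := [set v : tvert s | leaf_lo v <= t %% leaves s < leaf_hi v]%N.
have sub : A \subset None |: [set Some (Ordinal tm, v) | v in B].
  apply/fintype.subsetP; elim/tvert_ind => [i v|]; rewrite !inE //= => itv; apply/imsetP.
  have /andP[lh hn] := leaf_bounds v.
  have iE : (t %/ leaves s)%N = i.
    move/andP: itv => [it ti]; apply/eqP; rewrite eqn_leq -ltnS ltn_divLR ?leaves_gt0//.
    rewrite leq_divRL ?leaves_gt0// (leq_trans (leq_addr _ _) it) andbT mulSn addnC.
    by apply: leq_trans ti _; rewrite leq_add2l.
  exists v; last by congr (Some (_, _)); exact: val_inj.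
  move: itv; rewrite inE {1 2}(divn_eq t (leaves s)) iE.
  by rewrite leq_add2l ltn_add2l.
rewrite (leq_trans (subset_leq_card sub))// (leq_trans (leq_card_setU _ _).1)//.
by rewrite cards1 add1n ltnS (leq_trans (leq_imset_card _ _)) ?IH.
Qed.

Lemma tree_pathwidth s : Pathwidth (size s) (tree s).
Proof.
apply: (@pathwidth_interval (tree s) (leaves s) _ (@leaf_lo s) (@leaf_hi s)).
- exact: leaves_gt0.
- exact: leaf_bounds.
- move=> u v; have /andP[lu _] := leaf_bounds u; have /andP[lv _] := leaf_bounds v.
  by rewrite /= /tedge => /orP[] /child_leaf[]; lia.
- exact: card_leaf_bag.
Qed.

Lemma udist_sym s (u v : tvert s) : udist u v = udist v u.
Proof.
elim: s u v => [//|[m L] s IH] u v;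
  elim/tvert_ind: u => [i x|]; elim/tvert_ind: v => [j y|] //=.
by rewrite eq_sym; case: eqP => // _; apply: IH.
Qed.

Lemma udist_refl s (u : tvert s) : udist u u = 0.
Proof. by elim: s u => [//|[m L] s IH] u; elim/tvert_ind: u => [i x|] //=; rewrite eqxx. Qed.

Lemma udist_ge0 s (u v : tvert s) : scales s -> 0 <= udist u v.
Proof.
elim: s u v => [//|[m L] s IH] u v /= [/ltW L0 _ ss].
by elim/tvert_ind: u => [i x|]; elim/tvert_ind: v => [j y|] //=;
  case: ifP => // _; apply: IH.
Qed.

Lemma udist_le s (u v : tvert s) L : 0 <= L -> (forall e, e \in s -> e.2 <= L) ->
  udist u v <= L.
Proof.
move=> L0; elim: s u v => [//|[m L'] s IH] u v sL /=.
have LL : L' <= L by apply: (sL (m, L')); rewrite mem_head.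
elim/tvert_ind: u => [i x|]; elim/tvert_ind: v => [j y|] //=;
  case: ifP => // _; apply: IH => e es.
by apply: sL; rewrite inE es orbT.
Qed.

Lemma udist_triangle s (u v w : tvert s) : scales s ->
  udist u w <= udist u v + udist v w.
Proof.
elim: s u v w => [|[m L] s IH] u v w; first by rewrite addr0.
move=> /= [/ltW L0 sL ss]; have uL x y : udist x y <= L := udist_le x y L0 sL.
have u0 (x y : tvert s) : 0 <= udist x y := udist_ge0 _ _ ss.
elim/tvert_ind: u => [i x|]; elim/tvert_ind: v => [j y|]; elim/tvert_ind: w => [l z|] /=.
- have [ij|ij] := eqVneq i j; have [jl|jl] := eqVneq j l.
  + by rewrite ij jl eqxx; apply: IH.
  + by rewrite ij (negbTE jl) lerDr.
  + by rewrite -jl (negbTE ij) lerDl.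
  + by case: ifP => _; have := uL x z; lra.
- by rewrite lerDr; case: ifP.
- by case: ifP => _; have := uL x z; lra.
- by rewrite addr0.
- by rewrite lerDl; case: ifP.
- by lra.
- by rewrite add0r.
- by rewrite addr0.
Qed.

Lemma edgesP s e : e \in edges s -> scales s ->
  [/\ child e.1.1 e.1.2, udist e.1.1 e.1.2 = e.2 & 0 < e.2].
Proof.
elim: s e => [//|[m L] s IH] e /=.
move=> /flattenP[_ /mapP[i _ ->]]; rewrite inE => /orP[/eqP -> [L0 _ _]|] /=.
  by rewrite !eqxx.
move=> /mapP[e' e'E ->] [_ _ /(IH _ e'E)[? ? ?]] /=.
by rewrite eqxx.
Qed.

Lemma child_in_edges s (u v : tvert s) : child u v ->
  exists2 e, e \in edges s & e.1 = (u, v).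
Proof.
elim: s u v => [//|mL s IH] u v.
elim/tvert_ind: u => [i x|]; elim/tvert_ind: v => [j y|] //=.
  move=> /andP[/eqP <- /IH[e es ee]].
  exists ((Some (i, x), Some (i, y)), e.2) => //.
  apply/flattenP; eexists; first by apply/mapP; exists i; rewrite ?mem_enum.
  by rewrite inE; apply/orP; right; apply/mapP; exists e; rewrite ?ee.
move=> /eqP yr; exists ((None, Some (j, y)), mL.2) => //.
apply/flattenP; eexists; first by apply/mapP; exists j; rewrite ?mem_enum.
by rewrite yr mem_head.
Qed.

End Tree.

(** * Walks *)

Section Walks.
Variables (R : realType) (Y : sgraph) (l : edge_length R Y).
Implicit Types (x y z : Y) (p q : seq Y) (S : {set Y}) (a b : R).

Lemma walk_length_nil x : walk_length l x [::] = 0.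
Proof. by rewrite /walk_length big_nil. Qed.

Lemma walk_length_cons x y p : walk_length l x (y :: p) = l x y + walk_length l y p.
Proof. by rewrite /walk_length /= big_cons. Qed.

Lemma walks_cat x y z p q : walks x y p -> walks y z q -> walks x z (p ++ q).
Proof. by move=> [pp <-] [qq <-]; split; rewrite ?cat_path ?last_cat// pp. Qed.

(** The starting point [x] is exempt from lying in [S], which is why [reach_sym] asks for
    [x \in S]. *)
Definition reach S a x y : Prop :=
  exists p, [/\ walks x y p, {subset p <= S} & walk_length l x p <= a].

Lemma reach_refl S x : reach S 0 x x.
Proof. by exists [::]; split; rewrite ?walk_length_nil. Qed.

Lemma reach_trans S a b x y z : reach S a x y -> reach S b y z ->
  reach S (a + b) x z.
Proof.
move=> [p [wp pS pa]] [q [wq qS qb]]; exists (p ++ q); split.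
- exact: walks_cat wp wq.
- by move=> w; rewrite mem_cat => /orP[/pS|/qS].
- by rewrite walk_length_cat (proj2 wp) lerD.
Qed.

Lemma reach_le S S' a b x y : {subset S <= S'} -> a <= b ->
  reach S a x y -> reach S' b x y.
Proof.
move=> SS ab [p [wp pS pa]]; exists p; split => //; last exact: le_trans ab.
by move=> w /pS /SS.
Qed.

Lemma reach_sym S a x y : x \in S -> reach S a x y -> reach S a y x.
Proof.
move=> + [p [[pp pl] + +]]; elim: p x a pp pl => [|z p IH] x a /=.
  by move=> _ <- xS _; exists [::].
move=> /andP[exz pz] lz xS zpS; rewrite walk_length_cons => la.
have zS : z \in S by apply: zpS; rewrite mem_head.
have yz : reach S (a - l x z) y z.
  apply: IH => //; last by rewrite lerBrDl.
  by move=> w wp; apply: zpS; rewrite inE wp orbT.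
rewrite -(subrK (l x z) a); apply: reach_trans yz _.
exists [:: x]; split.
- by split; rewrite //= edge_sym exz.
- by move=> w; rewrite inE => /eqP ->.
- by rewrite walk_length_cons walk_length_nil addr0 (len_sym l exz).
Qed.

Lemma reach_prefix S x y z p : walks x y p -> {subset p <= S} -> z \in p ->
  reach S (walk_length l x p) x z.
Proof.
move=> [pp _] + zp; case/splitPr: zp pp => p1 p2.
rewrite -cat_rcons cat_path => /andP[pp1 pp2] pS.
exists (rcons p1 z); split.
- by split; rewrite ?last_rcons.
- by move=> w wp; apply: pS; rewrite mem_cat wp.
- by rewrite walk_length_cat lerDl walk_length_ge0.
Qed.

(** Follow the walk edge by edge. Some bag [t] contains the current edge: if [t] is at or beyond
    [b], the current vertex lies in bags on both sides of [b], hence in [bag b]; otherwise continue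
    from the next vertex with [t] in place of [a]. *)
Lemma walk_meets_bag n (bag : path_graph n -> {set Y}) (a b c : 'I_n) x y p :
  tree_decomposition bag -> x \in bag a -> y \in bag c -> (a <= b <= c)%N ->
  walks x y p -> exists2 z, z \in x :: p & z \in bag b.
Proof.
move=> dec + yc /andP[+ bc] [+ +].
have conn v : induces_connected [set t | v \in bag t] := @td_subtree _ _ _ dec v.
elim: p x a => [|z p IH] x a xa ab /=.
  move=> _ xy; exists x; rewrite ?mem_head//.
  apply: (path_decomposition_interval (@conn x) xa (c := c)).
    by rewrite xy.
  by rewrite ab.
move=> /andP[exz pz] lz.
have [t /andP[xt zt]] := td_edge dec exz.
have [tb|bt] := leqP b t.
  exists x; rewrite ?mem_head//.
  by apply: (path_decomposition_interval (@conn x) xa xt); rewrite ab.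
have [w wp wb] := IH z t zt (ltnW bt) pz lz.
by exists w => //; rewrite inE wp orbT.
Qed.

(** Passing from one of the sets to another costs at least [d], so a walk pays [d] for every set it
    meets besides the one where it starts. *)
Lemma walk_visits (I : finType) (J : {set I}) (A : I -> {set Y}) (d : R) i0 x p :
  0 < d ->
  (forall i j x y q, i \in J -> j \in J -> i != j -> x \in A i -> y \in A j ->
    walks x y q -> d <= walk_length l x q) ->
  i0 \in J -> x \in A i0 -> path (@edge Y) x p ->
  (forall i, i \in J -> exists2 z, z \in x :: p & z \in A i) ->
  d * #|J :\ i0|%:R <= walk_length l x p.
Proof.
move=> d0 sep.
(* The sets are disjoint, since the empty walk has length 0, below [d]. *)
have uni i j y : i \in J -> j \in J -> y \in A i -> y \in A j -> i = j.
  move=> iJ jJ yi yj; have [//|ij] := eqVneq i j.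
  have /(_ [::] (conj isT erefl)) := sep _ _ _ _ _ iJ jJ ij yi yj.
  by rewrite walk_length_nil leNgt d0.
pose V r := [set i in J | has [in A i] r].
have VS r i : (i \in V r) = (i \in J) && has [in A i] r by rewrite inE.
(* The length of [q], walked since [x0], is held in reserve until another set is reached. *)
have gen r : forall x0 q y i0, i0 \in J -> x0 \in A i0 -> walks x0 y q ->
    path (@edge Y) y r ->
    d * #|V r :\ i0|%:R <= walk_length l x0 q + walk_length l y r.
  elim: r => [|z r IH] x0 q y {}i0 i0J x0i wq /=.
    move=> _; rewrite walk_length_nil addr0.
    rewrite (_ : V [::] :\ i0 = finset.set0) ?cards0 ?mulr0 ?walk_length_ge0 ?(proj1 wq)//.
    by apply/setP => i; rewrite !inE /= !andbF.
  move=> /andP[eyz pr].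
  have wqz : walks x0 z (q ++ [:: z]).
    by apply: walks_cat wq _; split; rewrite //= eyz.
  have lqz : walk_length l x0 (q ++ [:: z]) = walk_length l x0 q + l y z.
    by rewrite walk_length_cat (proj2 wq) walk_length_cons walk_length_nil addr0.
  rewrite walk_length_cons addrA -lqz.
  (* [A i0] is the set visited last, and the walk entered it at [x0]. *)
  case: (pickP [pred i | [&& i \in J, i != i0 & z \in A i]]) => [i1|none].
    move=> /and3P[i1J i10 zi1].
    have sub : V (z :: r) :\ i0 \subset i1 |: (V r :\ i1).
      apply/fintype.subsetP => i; rewrite !inE /= => /and3P[_ iJ /orP[zi|ri]].
        by rewrite (uni _ _ _ iJ i1J zi zi1) eqxx.
      by rewrite iJ ri; case: eqP.
    have c1 : (#|V (z :: r) :\ i0| <= 1 + #|V r :\ i1|)%N.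
      by rewrite (leq_trans (subset_leq_card sub))// cardsU1 !inE eqxx.
    have := IH z [::] z i1 i1J zi1 (conj isT erefl) pr.
    rewrite walk_length_nil add0r => IHz.
    (* From [x0] to [z] the walk leads from [A i0] to [A i1], so the reserve pays [d]; counting
       restarts at [z]. *)
    have dz : d <= walk_length l x0 (q ++ [:: z]).
      by apply: sep wqz; rewrite 1?eq_sym //; [exact: i0J|exact: i1J| |..].
    rewrite -(ler_nat R) natrD in c1.
    apply: le_trans (lerD dz IHz); rewrite -[X in X + _]mulr1 -mulrDr.
    by rewrite ler_wpM2l// ltW.
  have sub : V (z :: r) :\ i0 \subset V r :\ i0.
    apply/fintype.subsetP => i; rewrite !inE /= => /and3P[ii0 iJ zr].
    by move: zr (none i); rewrite /= iJ ii0 /= => /orP[->//|->].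
  apply: le_trans (IH x0 _ z i0 i0J x0i wqz pr).
  by rewrite ler_wpM2l ?ler_nat ?subset_leq_card// ltW.
move=> i0J xi0 pp vis.
have := gen p x [::] x i0 i0J xi0 (conj isT erefl) pp.
rewrite walk_length_nil add0r; apply: le_trans.
rewrite ler_wpM2l ?(ltW d0)// ler_nat subset_leq_card//.
apply/fintype.subsetP => i; rewrite !inE => /andP[ii0 iJ].
rewrite ii0 iJ /=; have [z + zi] := vis i iJ.
rewrite inE => /orP[/eqP zx|zp]; last by apply/hasP; exists z.
by move: ii0; rewrite (uni i i0 x) ?eqxx// -zx.
Qed.

End Walks.

(** * Cheap drawings fill a bag *)

Section Core.
Variable R : realType.
Implicit Types s : seq (nat * R).

Definition stretch s (g : tvert s -> tvert s -> R) : R :=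
  \sum_(e <- edges s) g e.1.1 e.1.2 / e.2.

Lemma stretch_cons mL s (g : tvert (mL :: s) -> tvert (mL :: s) -> R) :
  stretch g = \sum_(i < mL.1.+1) (g None (Some (i, troot s)) / mL.2 +
    stretch (fun u v : tvert s => g (Some (i, u)) (Some (i, v)))).
Proof.
rewrite /stretch /= big_flatten big_map enumT /=; apply: eq_bigr => i _.
by rewrite big_cons big_map.
Qed.

Lemma size_edges mL s :
  size (edges (mL :: s)) = (mL.1.+1 * (size (edges s)).+1)%N.
Proof.
rewrite /= size_flatten /shape -map_comp sumnE big_map enumT.
rewrite (eq_bigr (fun=> (size (edges s)).+1)) ?sum_nat_const ?card_ord//.
by move=> i _; rewrite /= size_map.
Qed.

(** [S] may be any set containing the drawing; the induction replaces it by a ball around the drawn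
    root of each copy. *)
Definition drawing (Y : sgraph) s (f : tvert s -> Y) (p : tvert s -> tvert s -> seq Y)
    (S : {set Y}) : Prop :=
  [/\ forall u, f u \in S,
      forall u v, child u v -> walks (f u) (f v) (p u v) &
      forall u v, child u v -> {subset p u v <= S}].

Definition drawing_stretch (Y : sgraph) (l : edge_length R Y) s (f : tvert s -> Y)
    (p : tvert s -> tvert s -> seq Y) : R :=
  stretch (fun u v => walk_length l (f u) (p u v)).

Lemma stretch_ge0 (Y : sgraph) (l : edge_length R Y) s (f : tvert s -> Y) p S :
  scales s -> drawing f p S -> 0 <= drawing_stretch l f p.
Proof.
move=> ss [_ w _]; rewrite /drawing_stretch /stretch big_seq sumr_ge0// => e eE.
have [ce _ /ltW e0] := edgesP eE ss.
by rewrite divr_ge0// walk_length_ge0// (proj1 (w _ _ ce)).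
Qed.

Lemma subdrawing (Y : sgraph) mL s (f : tvert (mL :: s) -> Y) p S i :
  drawing f p S ->
  drawing (fun u : tvert s => f (Some (i, u)))
    (fun u v : tvert s => p (Some (i, u)) (Some (i, v))) S.
Proof.
by move=> [fS w pS]; split => [u|u v uv|u v uv];
  [exact: fS|apply: w|apply: pS]; rewrite /= eqxx.
Qed.

(** An edge of length at most [L] adds to the stretch at least its drawn length divided by [L], so
    the drawn path from the root to any vertex has length at most [L] times the stretch. *)
Lemma drawing_reach (Y : sgraph) (l : edge_length R Y) s (f : tvert s -> Y) p S L :
  scales s -> 0 <= L -> (forall e, e \in s -> e.2 <= L) -> drawing f p S ->
  (forall u, reach l S (L * drawing_stretch l f p) (f (troot s)) (f u)) /\
  (forall u v y, child u v -> y \in p u v ->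
    reach l S (L * drawing_stretch l f p) (f (troot s)) y).
Proof.
move=> + L0; elim: s f p => [|[m L'] s IH] f p ss sL dr.
  split => // u; case: u; apply: reach_le (reach_refl l S _) => //.
  by rewrite mulr_ge0 ?(stretch_ge0 _ ss dr).
have [fS w pS] := dr.
case: (ss) => L'0 _ ss'.
have L'L : L' <= L by apply: (sL (m, L')); rewrite mem_head.
have sL' e : e \in s -> e.2 <= L by move=> es; apply: sL; rewrite inE es orbT.
have dri i := subdrawing i dr.
have cr i : child (None : tvert ((m, L') :: s)) (Some (i, troot s)) by rewrite /=.
pose leg i := walk_length l (f None) (p None (Some (i, troot s))).
pose sub i := drawing_stretch l (fun u : tvert s => f (Some (i, u)))
    (fun u v : tvert s => p (Some (i, u)) (Some (i, v))).
have sub0 i : 0 <= sub i by apply: stretch_ge0 ss' (dri i).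
have leg0 i : 0 <= leg i by rewrite walk_length_ge0// (proj1 (w _ _ (cr i))).
have tot i : leg i + L * sub i <= L * drawing_stretch l f p.
  have summand0 j : 0 <= leg j / L' + sub j by rewrite addr_ge0 ?divr_ge0 ?(ltW L'0).
  apply: (@le_trans _ _ (L * (leg i / L' + sub i))).
    rewrite mulrDr lerD2r -{1}[leg i](divfK (lt0r_neq0 L'0)) mulrC ler_wpM2r//.
    by rewrite divr_ge0 ?(ltW L'0).
  rewrite ler_wpM2l// /drawing_stretch stretch_cons (bigD1 i)//= lerDl.
  by rewrite sumr_ge0// => j _; apply: summand0.
have tot0 i : leg i <= L * drawing_stretch l f p.
  by apply: le_trans (tot i); rewrite lerDl mulr_ge0.
have legr i : reach l S (leg i) (f None) (f (Some (i, troot s))).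
  by exists (p None (Some (i, troot s))); split; [exact: w|exact: pS|].
have IHi i := IH _ _ ss' sL' (dri i).
split.
  elim/tvert_ind => [i u|].
    exact: reach_le (tot i) (reach_trans (legr i) ((IHi i).1 u)).
  by apply: reach_le (reach_refl l S _); rewrite // (le_trans _ (tot0 ord0)).
elim/tvert_ind => [i u|]; elim/tvert_ind => [j v|] y //=.
  move=> /andP[/eqP <-] uv yp.
  exact: reach_le (tot i) (reach_trans (legr i) ((IHi i).2 u v y uv yp)).
move=> /eqP vr; rewrite vr => yp.
apply: reach_le (tot0 j) (reach_prefix l (w _ _ (cr j)) (pS _ _ (cr j)) yp).
by [].
Qed.

(** [(size (edges s)).+1] counts the edges of a copy together with the edge leading to it, so by
    [size_edges] the next tree has [m + 1] times as many edges. *)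
Definition forces_bag s (C : R) : Prop :=
  forall (Y : sgraph) (l : edge_length R Y) n (bag : path_graph n -> {set Y})
    (f : tvert s -> Y) p S,
  tree_decomposition bag -> drawing f p S ->
  (forall u v q, walks (f u) (f v) q -> udist u v <= walk_length l (f u) q) ->
  drawing_stretch l f p <= C * (size (edges s)).+1%:R ->
  exists t, (size s < #|bag t :&: S|)%N.

Lemma forces_bag_nil C : forces_bag [::] C.
Proof.
move=> Y l n bag f p S dec [fS _ _] _ _.
have [t ft] := td_vertex dec (f tt); exists t.
by rewrite /= card_gt0; apply/set0Pn; exists (f tt); rewrite inE ft fS.
Qed.

Lemma scales_bound s : exists2 L : R, 0 < L & forall e, e \in s -> e.2 <= L.
Proof.
elim: s => [|[m L'] s [L L0 sL]]; first by exists 1.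
exists (Num.max L L'); first by rewrite lt_max L0.
move=> e; rewrite inE => /orP[/eqP ->|/sL eL]; rewrite le_max ?lexx ?orbT//.
by rewrite eL.
Qed.

(** Markov's inequality: every index outside the set contributes at least [K] to the sum. *)
Lemma many_small (m : nat) (g : 'I_m -> R) (K : R) :
  0 < K -> (forall i, 0 <= g i) -> \sum_i g i <= K * m%:R / 2 ->
  m%:R / 2 <= #|[set i | g i <= K]|%:R :> R.
Proof.
move=> K0 g0 gK; set J := [set i | _].
have : K * #|~: J|%:R <= \sum_i g i.
  rewrite (bigID [in ~: J])/= -[leLHS]addr0 lerD ?sumr_ge0//.
  rewrite -sum1_card natr_sum mulr_sumr ler_sum// => i.
  by rewrite !inE -ltNge mulr1 => /ltW.
have cJ : #|J|%:R + #|~: J|%:R = m%:R :> R by rewrite -natrD cardsC card_ord.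
move=> /le_trans/(_ gK); rewrite -mulrA ler_pM2l// => cC.
by move: cC cJ; lra.
Qed.

(** [K] is the stretch allowed to a copy by the hypothesis with [4 * C], and bounds that of at least
    half of the copies. [L] makes balls of radius [L0 * K] in different copies more than [L / 2]
    apart, and [m] leaves enough cheap copies for the final count. *)
Lemma forces_bag_cons s (C L0 : R) : 0 < C -> 0 < L0 ->
  (forall e, e \in s -> e.2 <= L0) -> scales s -> forces_bag s (4 * C) ->
  let K := 4 * C * (size (edges s)).+1%:R in
  forall L m, L = 4 * (L0 * K) + L0 -> 8 * K + 8 < m%:R ->
  forces_bag ((m, L) :: s) C.
Proof.
move=> C0 L00 sL0 ss IH K L m LE mK Y l n bag f p S dec dr ncon cost.
have N0 : 0 < (size (edges s)).+1%:R :> R by rewrite ltr0n.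
have K0 : 0 < K by rewrite !mulr_gt0.
have L0K : 0 < L0 * K by rewrite mulr_gt0.
have Lgt0 : 0 < L by lra.
have [fS w pS] := dr.
have dri i := subdrawing i dr.
have cr (i : 'I_m.+1) : child (None : tvert ((m, L) :: s)) (Some (i, troot s)).
  by rewrite /=.
pose fi (i : 'I_m.+1) (u : tvert s) := f (Some (i, u)).
pose pi (i : 'I_m.+1) (u v : tvert s) := p (Some (i, u)) (Some (i, v)).
pose leg i := walk_length l (f None) (p None (Some (i, troot s))).
pose sub i := drawing_stretch l (fi i) (pi i).
have sub0 i : 0 <= sub i by apply: stretch_ge0 ss (dri i).
have leg0 i : 0 <= leg i / L.
  by rewrite divr_ge0 ?(ltW Lgt0)// walk_length_ge0// (proj1 (w _ _ (cr i))).
pose J := [set i | leg i / L + sub i <= K].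
have cardJ : m.+1%:R / 2 <= #|J|%:R :> R.
  apply: many_small => // [i|]; first by rewrite addr_ge0.
  have -> : \sum_i (leg i / L + sub i) = drawing_stretch l f p.
    by rewrite /drawing_stretch stretch_cons.
  apply: le_trans cost _; rewrite size_edges /= -natr1 natrM.
  (* This absorbs the extra 1 in the cost bound: [C * (M * N + 1)] is at most [2 * C * M * N], that
     is [K * M / 2]. *)
  have : 1 <= m.+1%:R * (size (edges s)).+1%:R :> R by rewrite -natrM ler1n.
  rewrite /K; move: (m.+1%:R) ((size (edges s)).+1%:R) => M N MN.
  by rewrite [leRHS](_ : _ = C * (2 * (M * N))) ?ler_pM2l//; [lra|field].
have legJ i : i \in J -> reach l S (K * L) (f None) (fi i (troot s)).
  rewrite inE => iJ; exists (p None (Some (i, troot s))); split; [exact: w|exact: pS|].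
  by rewrite -ler_pdivrMr// (le_trans _ iJ)// lerDl.
(* By [drawing_reach], this ball contains the whole drawing of a cheap copy. *)
pose A i := [set y in S | `[< reach l S (L0 * K) (fi i (troot s)) y >]].
have subK i : i \in J -> sub i <= K.
  by rewrite inE; apply: le_trans; rewrite lerDr.
have drA i : i \in J -> drawing (fi i) (pi i) (A i).
  move=> iJ; have [R1 R2] := drawing_reach l ss (ltW L00) sL0 (dri i).
  have L0s : L0 * sub i <= L0 * K by rewrite ler_pM2l ?subK.
  have [fiS wi piS] := dri i; split => // [u|u v uv y yp].
    rewrite inE fiS; apply/asboolP; exact: reach_le L0s (R1 u).
  rewrite inE (piS _ _ uv _ yp); apply/asboolP; exact: reach_le L0s (R2 u v y uv yp).
apply: contrapT => noT.
have {noT} small t : (#|bag t :&: S| <= (size s).+1)%N.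
  by rewrite leqNgt; apply/negP => tS; apply: noT; exists t.
(* The condition [i \in J] stands under the existential so that [choice] yields [t] on all
   indices. *)
have bagA i : exists t, i \in J -> bag t :&: S \subset A i /\ bag t :&: A i != finset.set0.
  have [iJ|_] := boolP (i \in J); last first.
    by have [t _] := td_vertex dec (f None); exists t.
  have nc u v q : walks (fi i u) (fi i v) q -> udist u v <= walk_length l (fi i u) q.
    by move=> /ncon; rewrite /= eqxx.
  have [t st] := IH Y l n bag (fi i) (pi i) (A i) dec (drA i iJ) nc (subK i iJ).
  exists t => _; split; last by rewrite -card_gt0 (leq_ltn_trans _ st).
  (* [bag t :&: A i] already has the maximal size allowed to [bag t :&: S]. *)
  have AS : bag t :&: A i \subset bag t :&: S.
    by apply: finset.setIS; apply/fintype.subsetP => y; rewrite inE => /andP[].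
  have /eqP <- : bag t :&: A i == bag t :&: S.
    by rewrite eqEcard AS (leq_trans (small t)).
  exact: subsetIr.
have [t tP] := choice bagA.
have [i0 i0J] : exists i0, i0 \in J.
  apply/set0Pn; rewrite -card_gt0 -(ltr_nat R) (lt_le_trans _ cardJ)//.
  by rewrite divr_gt0 ?ltr0n.
have [i1 i1J i1min] : exists2 i1, i1 \in J & forall i, i \in J -> (t i1 <= t i)%N.
  by case: (arg_minnP (fun i => t i : nat) i0J) => i1; exists i1.
have [i2 i2J i2max] : exists2 i2, i2 \in J & forall i, i \in J -> (t i <= t i2)%N.
  by case: (arg_maxnP (fun i => t i : nat) i0J) => i2; exists i2.
have [_ /set0Pn[x /setIP[xt xA]]] := tP i1 i1J.
have [_ /set0Pn[y /setIP[yt yA]]] := tP i2 i2J.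
have AP i z : z \in A i -> z \in S /\ reach l S (L0 * K) (fi i (troot s)) z.
  by rewrite inE => /andP[? /asboolP].
(* The walk goes from [x] to the root of copy [i1], to the main root, to the root of copy [i2], and
   on to [y]. *)
have [q [wq qS lq]] : reach l S (L0 * K + K * L + (K * L + L0 * K)) x y.
  have [xS xr] := AP _ _ xA; have [yS yr] := AP _ _ yA.
  apply: reach_trans (reach_trans (legJ i2 i2J) yr).
  apply: reach_trans (reach_sym _ xr) (reach_sym _ (legJ i1 i1J)); exact: fS.
(* Extended at both ends by walks of length at most [L0 * K], the walk [r] joins the roots of two
   copies, whose [udist] is [L]. *)
have sep i j a b r : i \in J -> j \in J -> i != j -> a \in A i -> b \in A j ->
    walks a b r -> L - 2 * (L0 * K) <= walk_length l a r.
  move=> iJ jJ ij /AP[aS ra] /AP[bS rb] wr.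
  have rr : reach l [set: Y] (walk_length l a r) a b.
    by exists r; split => // z _; rewrite inE.
  have tosetT c d e : reach l S c d e -> reach l [set: Y] c d e.
    by apply: reach_le => // z _; rewrite inE.
  have [r' [wr' _ lr']] := reach_trans (reach_trans (tosetT _ _ _ ra) rr)
     (tosetT _ _ _ (reach_sym (fS _) rb)).
  have := ncon _ _ _ wr'; rewrite /= (negbTE ij).
  by move: lr'; lra.
have vis i : i \in J -> exists2 z, z \in x :: q & z \in A i.
  move=> iJ; have [tA _] := tP i iJ.
  have [|z zq zt] := walk_meets_bag (b := t i) dec xt yt _ wq.
    by rewrite i1min ?i2max.
  exists z => //; move/fintype.subsetP: tA; apply; rewrite inE zt /=.
  by move: zq; rewrite inE => /orP[/eqP ->|/qS//]; have [] := AP _ _ xA.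
have d0 : 0 < L - 2 * (L0 * K) by lra.
have := walk_visits d0 sep i1J xA (proj1 wq) vis.
have cJ1 : #|J|%:R = 1 + #|J :\ i1|%:R :> R by rewrite (cardsD1 i1) i1J natrD.
move=> /le_trans/(_ lq).
(* The lower bound exceeds [2 * K * L + 3 * L / 2], whereas [q] has length at most
   [2 * K * L + 2 * L0 * K], less than [2 * K * L + L / 2]. *)
have : L / 2 * (4 * K + 3) < (L - 2 * (L0 * K)) * #|J :\ i1|%:R.
  apply: ltr_pM => //; rewrite ?divr_ge0 ?(ltW Lgt0)//; [by lra|by lra|].
  move: cardJ mK cJ1; rewrite -natr1; lra.
have := mulr_gt0 K0 Lgt0.
by move: LE; nra.
Qed.

(** [C] varies in the induction, because each new level requires its copies to force bags at four
    times the constant. *)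
Lemma forcing_tree j (C : R) : 0 < C ->
  exists s, [/\ size s = j, scales s & forces_bag s C].
Proof.
elim: j C => [|j IH] C C0; first by exists [::]; split => //; apply: forces_bag_nil.
have [s [sj ss sC]] := IH (4 * C) ltac:(by rewrite mulr_gt0).
have [L0 L00 sL0] := scales_bound s.
have K0 : 0 < 4 * C * (size (edges s)).+1%:R by rewrite !mulr_gt0.
have LK : 0 < L0 * (4 * C * (size (edges s)).+1%:R) by rewrite mulr_gt0.
have KK : 0 <= 8 * (4 * C * (size (edges s)).+1%:R) + 8 by lra.
exists ((Num.bound (8 * (4 * C * (size (edges s)).+1%:R) + 8),
  4 * (L0 * (4 * C * (size (edges s)).+1%:R)) + L0) :: s); split.
- by rewrite /= sj.
- split => //=; first by lra.
  by move=> e /sL0; lra.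
- by apply: (forces_bag_cons C0 L00 sL0 ss sC) => //; apply: archi_boundP.
Qed.

End Core.

(** * Stochastic embeddings *)

Lemma pathwidth_bags (G : sgraph) k : Pathwidth k G ->
  exists n (bag : path_graph n -> {set G}),
    tree_decomposition bag /\ forall t, (#|bag t| <= k.+1)%N.
Proof.
rewrite /Pathwidth /pathwidth; case: ex_minnP => w /asboolP[n [bag [dec wE]]] _ wk.
exists n, bag; split => // t.
have := @leq_bigmax _ (fun t => #|bag t|) t.
by move: wk; rewrite -wE /width; lia.
Qed.

Section Embedding.
Variables (R : realType) (s : seq (nat * R)).
Hypothesis ss : scales s.

Definition tree_len : edge_length R (tree s) :=
  @EdgeLength R (tree s) (@udist R s) (fun x y _ => udist_ge0 x y ss)
    (fun x y _ => udist_sym x y).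

Lemma udist_le_graph_dist (u v : tree s) : ((udist u v)%:E <= graph_dist tree_len u v)%E.
Proof.
apply: le_ereal_inf_tmp => _ [p [pp pv] <-]; rewrite lee_fin.
elim: p u pp pv => [|w p IH] u /=.
  by move=> _ <-; rewrite udist_refl walk_length_nil.
move=> /andP[uw wp] pv; rewrite walk_length_cons /=.
by rewrite (le_trans (udist_triangle u w v ss))// lerD2l IH.
Qed.

Lemma graph_dist_child (u v : tree s) : child u v ->
  (graph_dist tree_len u v <= (udist u v)%:E)%E.
Proof.
move=> uv; apply: ereal_inf_lbound; exists [:: v].
  by split; rewrite //= /tedge uv.
by rewrite walk_length_cons walk_length_nil addr0.
Qed.

(** Distances are infima, so edges are drawn as nearly shortest walks, with an excess of at most the
    edge length. This adds at most 1 per edge to the stretch, whence [C - 1]. The absolute value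
    makes the weights nonnegative for arbitrary [e]. *)
Lemma expensive_map (C : R) k (Y : finpmetric R) (F : tvert s -> Y) :
  forces_bag s C -> size s = k.+1 -> supported_on (Pathwidth k) Y ->
  (forall x y, ((udist x y)%:E <= dist (F x) (F y))%E) ->
  ~ (\sum_(e <- edges s) `|e.2^-1|%:E * dist (F e.1.1) (F e.1.2)
      <= ((C - 1) * (size (edges s)).+1%:R)%:E)%E.
Proof.
move=> sC sk [G Gk [l YE]]; subst Y => /= ncon cost.
have term0 e : (0 <= `|e.2^-1|%:E * graph_dist l (F e.1.1) (F e.1.2))%E.
  by rewrite mule_ge0 ?lee_fin// graph_dist_ge0.
(* A single infinite distance would make the weighted sum infinite. *)
have fin e : e \in edges s -> graph_dist l (F e.1.1) (F e.1.2) \is a fin_num.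
  move=> eE; have [_ _ e0] := edgesP eE ss.
  rewrite ge0_fin_numE ?graph_dist_ge0// ltey; apply/eqP => oo.
  move: cost; rewrite (big_rem e)//= oo mulry gtr0_sg ?normr_gt0 ?invr_neq0 ?lt0r_neq0//.
  rewrite mul1e addye ?leye_eq//.
  rewrite gt_eqF// (lt_le_trans ltNy0)// sume_ge0// => i _; exact: term0.
have near (uv : tvert s * tvert s) : exists p, child uv.1 uv.2 ->
    walks (F uv.1) (F uv.2) p /\
    walk_length l (F uv.1) p <= fine (graph_dist l (F uv.1) (F uv.2)) + udist uv.1 uv.2.
  have [cuv|_] := boolP (child uv.1 uv.2); last by exists [::].
  have [e eE e1] := child_in_edges cuv.
  have [_ ue e0] := edgesP eE ss.
  have := fin e eE; rewrite e1 => fe.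
  move: ue; rewrite e1 => ue; rewrite -ue in e0.
  have [_ [p wp <-] lp] := lb_ereal_inf_adherent e0 fe.
  exists p => _; split => //; rewrite -lee_fin EFinD fineK//.
  exact: ltW.
have [p pP] := choice near.
have [n [bag [dec bk]]] := pathwidth_bags Gk.
have [|||t] := sC G l n bag F (fun u v => p (u, v)) [set: G] dec.
- split=> [u|u v uv|u v uv y _]; rewrite ?inE//.
  by have [] := pP (u, v) uv.
- move=> u v q wq; rewrite -lee_fin (le_trans (ncon u v))//.
  by apply: ereal_inf_lbound; exists q.
- have : \sum_(e <- edges s) fine (graph_dist l (F e.1.1) (F e.1.2)) / e.2 <=
      (C - 1) * (size (edges s)).+1%:R.
    rewrite -lee_fin; apply: le_trans cost; rewrite -sumEFin big_seq [leRHS]big_seq.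
    apply: lee_sum => e eE; have [_ _ e0] := edgesP eE ss.
    by rewrite EFinM fineK ?fin// ger0_norm ?invr_ge0 ?(ltW e0)// muleC.
  have : drawing_stretch l F (fun u v => p (u, v)) <=
      \sum_(e <- edges s) (fine (graph_dist l (F e.1.1) (F e.1.2)) / e.2 + 1).
    rewrite /drawing_stretch /stretch big_seq [leRHS]big_seq ler_sum// => e eE.
    have [ce ue e0] := edgesP eE ss.
    have [_] := pP (e.1.1, e.1.2) ce; rewrite /= ue.
    by rewrite ler_pdivrMr// mulrDl divfK ?mul1r ?lt0r_neq0.
  rewrite big_split /= big_const_seq count_predT iter_addr_0 -natr1.
  by lra.
- by rewrite sk finset.setIT ltnNge bk.
Qed.

End Embedding.

(** Otherwise [h] is almost surely at least [c + 1], and so is its integral against a probability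
    measure. *)
Lemma exists_le_integral (R : realType) d (T : measurableType d)
    (P : probability T R) (h : T -> \bar R) (Q : T -> Prop) (c : R) :
  measurable_fun setT h -> (forall w, 0 <= h w)%E -> {ae P, forall w, Q w} ->
  (\int[P]_w h w <= c%:E)%E -> exists w, Q w /\ (h w <= (c + 1)%:E)%E.
Proof.
move=> mh h0 aeQ hc.
have c0 : 0 <= c.
  by rewrite -lee_fin (le_trans _ hc)// integral_ge0.
apply: contrapT => none.
have big w : Q w -> ((c + 1)%:E <= h w)%E.
  by move=> Qw; rewrite leNgt; apply/negP => /ltW hw; apply: none; exists w.
suff : ((c + 1)%:E <= c%:E)%E by rewrite lee_fin; lra.
apply: le_trans hc.
have <- : (\int[P]_w (cst (c + 1)%:E) w = (c + 1)%:E)%E.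
  by rewrite integral_cst// -[RHS]mule1; congr (_ * _)%E; apply: probability_setT.
apply: ae_ge0_le_integral => //.
- by move=> w _; rewrite lee_fin; lra.
- by apply: filterS aeQ => w Qw _; apply: big.
Qed.


Theorem theorem1p7 (R : realType) (k : nat) (hk : (1 <= k)%N) :
  ~ embeds_into R (familyI (Pathwidth k.+1) Trees) (Pathwidth k).
Proof.
move=> [D emb].
(* With [E] edges, some outcome costs at most [|D| * E + 1], which is at most [(|D| + 1) * (E + 1)];
   [expensive_map] with [C = |D| + 2] excludes this. *)
have C0 : (0 < `|D| + 2)%R by rewrite ltr_wpDl.
have [s [sk ss sC]] := forcing_tree k.+1 C0.
have [] := emb (graph_metric (tree_len ss)).
  exists (tree s); last by exists (tree_len ss).
  by split; [rewrite -sk; exact: tree_pathwidth|exact: tree_is_tree].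
move=> d [T [P [Y [F [supp meas ncon cost]]]]].
(* Only this one linear combination of distances is averaged; each edge contributes at most [|D|] to
   its expectation. *)
pose h w := (\sum_(e <- edges s)
  `|e.2^-1|%:E * dist (F w (e.1.1 : tree s)) (F w (e.1.2 : tree s)))%E.
have [|||w [Qw hw]] := @exists_le_integral R d T P h _ (`|D| * (size (edges s))%:R) _ _ ncon.
- by apply: emeasurable_sum => e; apply: measurable_funeM.
- by move=> w; apply: sume_ge0 => e _; rewrite mule_ge0 ?lee_fin// dist_ge0.
- rewrite ge0_integral_sum//; last 2 first.
  + by move=> e; apply: measurable_funeM.
  + by move=> e w _; rewrite mule_ge0 ?lee_fin// dist_ge0.
  apply: (@le_trans _ _ (\sum_(e <- edges s) `|D|%:E)%E); last first.
    by rewrite sumEFin big_const_seq count_predT iter_addr_0 mulr_natr.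
  rewrite big_seq [leRHS]big_seq; apply: lee_sum => e eE.
  have [ce ue e0] := edgesP eE ss.
  rewrite ge0_integralZl_EFin//; last by move=> w _; exact: dist_ge0.
  rewrite ger0_norm ?invr_ge0 ?(ltW e0)// muleC lee_pdivrMr//.
  apply: le_trans (cost _ _) _.
  apply: (@le_trans _ _ (`|D|%:E * graph_dist (tree_len ss) e.1.1 e.1.2)%E).
    by rewrite lee_wpmul2r ?graph_dist_ge0// lee_fin ler_norm.
  by rewrite lee_wpmul2l ?lee_fin// -ue; apply: graph_dist_child.
apply: (expensive_map ss (F := fun x => F w x) sC sk (supp w)).
  by move=> x y; apply: le_trans (udist_le_graph_dist ss x y) (Qw x y).
apply: le_trans hw _; rewrite lee_fin -natr1.
have := normr_ge0 D; have := ler0n R (size (edges s)); nra.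
Qed.
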